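(* Let $K$ be a field, $s,d$ positive integers, and $$G_\Gamma=\{x_{\mathbf{a}+\mathbf{e}_i}x_{\mathbf{b}+\mathbf{e}_j}-x_{\mathbf{a}+\mathbf{e}_j}x_{\mathbf{b}+\mathbf{e}_i}\mid \mathbf{a},\mathbf{b}\in\mathbb{N}^s_{d-1},\ 1\le i<j\le s\}\subset R^{[d]}.$$ Then $G_\Gamma$ is a Gröbner basis of $\ker\phi_d$ with respect to the term order $\prec_\Gamma$ on $R^{[d]}$.
   Context: $\mathbb{N}=\{0,1,2,\dots\}$; $\mathbb{N}^s_d=\{\mathbf{a}\in\mathbb{N}^s\mid a_1+\dots+a_s=d\}$; $\mathbf{e}_i$ is the $i$-th standard unit vector. $S=K[y_1,\dots,y_s]$, $R^{[d]}=K[x_{\mathbf{a}}\mid\mathbf{a}\in\mathbb{N}^s_d]$ is a polynomial ring, and $\phi_d:R^{[d]}\to S$ is the $K$-algebra homomorphism with $\phi_d(x_{\mathbf{a}})=\mathbf{y}^{\mathbf{a}}=y_1^{a_1}\cdots y_s^{a_s}$. Lexicographic order on $\mathbb{N}^s$: $\mathbf{a}\prec_{lex}\mathbf{b}$ if $a_j<b_j$ where $j=\min\{i\mid a_i\ne b_i\}$. Reverse lexicographic order: given a total order on the variables of a polynomial ring, for monomials $u,v$ one sets $u\prec v$ if $\deg u<\deg v$, or $\deg u=\deg v$ and the smallest variable having different exponents in $u$ and $v$ has a strictly larger exponent in $u$ than in $v$. For $\mathbf{a}\in\mathbb{N}^s$, $\Gamma(\mathbf{a})\in\mathbb{N}^s$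 is the vector obtained by rearranging the entries of $\mathbf{a}$ in weakly increasing order. $\prec_\Gamma$ is the reverse lexicographic order on $R^{[d]}$ for the following order on the variables: $x_{\mathbf{a}}\prec_\Gamma x_{\mathbf{b}}$ if $\Gamma(\mathbf{b})\prec_{lex}\Gamma(\mathbf{a})$, or $\Gamma(\mathbf{b})=\Gamma(\mathbf{a})$ and $\mathbf{b}\prec_{lex}\mathbf{a}$. *)

(* Defs.v *)
From HB Require Import structures.
From mathcomp Require Import all_boot all_order all_algebra.
From mathcomp.multinomials Require Export mpoly.

Set Implicit Arguments.
Unset Strict Implicit.
Unset Printing Implicit Defensive.

Import GRing.Theory.
Local Open Scope ring_scope.

Section TermOrders.
Variable n : nat.
Implicit Types (u v w : 'X_{1..n}).

Record term_order := TermOrder {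
  to_lt :> rel 'X_{1..n};
  to_irr : irreflexive to_lt;
  to_trans : transitive to_lt;
  to_total : forall u v, u != v -> to_lt u v || to_lt v u;
  to_add : forall u v w, to_lt u v -> to_lt (u + w)%MM (v + w)%MM;
  to_min : forall u, u != 0%MM -> to_lt 0%MM u }.

(* At the [vlt]-smallest index where [u] and [v] differ, [u] is smaller. *)
Definition first_lt (vlt : rel 'I_n) u v : bool :=
  [exists i, (u i < v i)%N && [forall j, vlt j i ==> (u j == v j)]].

Definition lex_lt u v : bool := first_lt (fun i j => (i < j)%N) u v.

(* The variable order is [vlt]; the smallest differing variable has the
   larger exponent in the smaller monomial. *)
Definition revlex_lt (vlt : rel 'I_n) u v : bool :=
  (mdeg u < mdeg v)%N || (mdeg u == mdeg v) && first_lt vlt v u.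

Section FirstLt.
Variable vlt : rel 'I_n.
Hypothesis virr : irreflexive vlt.
Hypothesis vtr : transitive vlt.
Hypothesis vtot : forall i j, i != j -> vlt i j || vlt j i.

Lemma first_ltP u v :
  reflect (exists2 i, (u i < v i)%N & forall j, vlt j i -> u j = v j)
          (first_lt vlt u v).
Proof.
apply: (iffP existsP) => [[i /andP[lti /forallP H]]|[i lti H]]; exists i => //.
  by move=> j ji; apply/eqP; exact: (implyP (H j)).
by rewrite lti; apply/forallP => j; apply/implyP => /H ->.
Qed.

Lemma first_lt_irr : irreflexive (first_lt vlt).
Proof. by move=> u; apply/first_ltP => -[i]; rewrite ltnn. Qed.

Lemma first_lt_trans : transitive (first_lt vlt).
Proof.
move=> v u w /first_ltP[i ui Hi] /first_ltP[k vk Hk]; apply/first_ltP.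
have [eik|/vtot/orP[ik|ki]] := eqVneq i k.
- rewrite -{k}eik in vk Hk; exists i; first exact: ltn_trans vk.
  by move=> j ji; rewrite Hi // Hk.
- by exists i => [|j ji]; [rewrite -Hk | rewrite Hi // Hk // (vtr ji)].
- by exists k => [|j jk]; [rewrite Hi | rewrite Hi ?Hk // (vtr jk)].
Qed.

Lemma first_lt_total u v : u != v -> first_lt vlt u v || first_lt vlt v u.
Proof.
move=> neq.
have [i0 Pi0] : exists i, u i != v i.
  by apply/existsP; apply: contraR neq; rewrite negb_exists => /forallP H;
     apply/eqP/mnmP => i; apply/eqP; rewrite -[_ == _]negbK.
case: (@arg_minnP _ i0 (fun i => u i != v i) (fun i => #|[pred j | vlt j i]|)
  Pi0) => i Pi mini.
have below j : vlt j i -> u j = v j.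
  move=> ji; apply/eqP; apply: contraTT isT => /mini; rewrite leqNgt.
  case/negP; apply: proper_card; apply/properP; split.
    by apply/subsetP => k; rewrite !inE => /vtr; apply.
  by exists j; rewrite !inE ?virr.
case: ltngtP Pi => // [lt|gt] _; apply/orP; [left|right]; apply/first_ltP;
  exists i => // j /below //.
Qed.

Lemma first_lt_add u v w :
  first_lt vlt u v -> first_lt vlt (u + w)%MM (v + w)%MM.
Proof.
case/first_ltP => i ui Hi; apply/first_ltP; exists i => [|j /Hi e].
  by rewrite !mnmDE ltn_add2r.
by rewrite !mnmDE e.
Qed.

Lemma revlex_irr : irreflexive (revlex_lt vlt).
Proof. by move=> u; rewrite /revlex_lt ltnn first_lt_irr andbF. Qed.

Lemma revlex_trans : transitive (revlex_lt vlt).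
Proof.
move=> v u w; rewrite /revlex_lt.
case/orP => [uv|/andP[/eqP -> uv]]; case/orP => [vw|/andP[/eqP <- vw]].
- by rewrite (ltn_trans uv vw).
- by rewrite uv.
- by rewrite vw.
- by rewrite eqxx (first_lt_trans vw uv) orbT.
Qed.

Lemma revlex_total u v : u != v -> revlex_lt vlt u v || revlex_lt vlt v u.
Proof.
by rewrite /revlex_lt => /first_lt_total; case: ltngtP => //= _; rewrite orbC.
Qed.

Lemma revlex_add u v w :
  revlex_lt vlt u v -> revlex_lt vlt (u + w)%MM (v + w)%MM.
Proof.
rewrite /revlex_lt !mdegD ltn_add2r eqn_add2r.
by case/orP => [->//|/andP[-> /first_lt_add ->]]; rewrite orbT.
Qed.

Lemma revlex_min u : u != 0%MM -> revlex_lt vlt 0%MM u.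
Proof. by rewrite -mdeg_eq0 /revlex_lt mdeg0 lt0n => ->. Qed.

Definition revlex : term_order :=
  TermOrder revlex_irr revlex_trans revlex_total revlex_add revlex_min.

End FirstLt.

Let ltn_ord_total (i j : 'I_n) : i != j -> (i < j)%N || (j < i)%N.
Proof. by rewrite -(inj_eq val_inj) neq_ltn. Qed.

Lemma lex_lt_irr : irreflexive lex_lt.
Proof. by move=> u; exact: first_lt_irr. Qed.

Lemma lex_lt_trans : transitive lex_lt.
Proof.
apply: first_lt_trans => [j i k|]; [exact: ltn_trans | exact: ltn_ord_total].
Qed.

Lemma lex_lt_total u v : u != v -> lex_lt u v || lex_lt v u.
Proof.
apply: first_lt_total => [i|j i k]; [exact: ltnn | exact: ltn_trans].
Qed.

End TermOrders.

Section Groebner.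
Variables (K : fieldType) (n : nat).
Local Notation R := {mpoly K[n]}.

Definition ideal_gen (A : R -> Prop) (f : R) : Prop :=
  exists (m : nat) (h g : 'I_m -> R),
    (forall k, A (g k)) /\ f = \sum_(k < m) h k * g k.

Definition is_initial (lt : term_order n) (f : R) (m : 'X_{1..n}) : Prop :=
  m \in msupp f /\ {in msupp f, forall m', m' != m -> lt m' m}.

(* The zero polynomial has no initial monomial and contributes nothing. *)
Definition initials (lt : term_order n) (A : R -> Prop) (p : R) : Prop :=
  exists f m, [/\ A f, is_initial lt f m & p = 'X_[m]].

Definition initial_ideal (lt : term_order n) (A : R -> Prop) : R -> Prop :=
  ideal_gen (initials lt A).

(* [G] is a finite set, given by an enumeration (possibly with repetitions);
   [I] is meant to be an ideal. *)
Definition is_groebner_basis (lt : term_order n) (G : seq R) (I : R -> Prop) :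
    Prop :=
  (forall g, g \in G -> I g) /\
  (forall f, initial_ideal lt I f <-> initial_ideal lt (fun g => g \in G) f).

End Groebner.

(* The finite set of exponent vectors of length [s] and total degree [d]. *)
Record mnmd (s d : nat) :=
  Mnmd { mnmd_val :> 'X_{1..s}; mnmd_deg : mdeg mnmd_val == d }.

Section MnmdFinite.
Variables s d : nat.
HB.instance Definition _ := [isSub for @mnmd_val s d].
HB.instance Definition _ := [Countable of mnmd s d by <:].

Let bound (a : mnmd s d) : (mdeg a < d.+1)%N.
Proof. by rewrite (eqP (mnmd_deg a)). Qed.

Let to_b (a : mnmd s d) : 'X_{1..s < d.+1} := BMultinom (bound a).
Let of_b (b : 'X_{1..s < d.+1}) : option (mnmd s d) := insub (bmnm b).
Let to_bK : pcancel to_b of_b.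
Proof. by move=> a; rewrite /of_b /= valK. Qed.

HB.instance Definition _ := isFinite.Build (mnmd s d) (pcan_enumP to_bK).
End MnmdFinite.

Section GammaOrder.
Variable s : nat.
Implicit Types a b : 'X_{1..s}.

Definition Gamma a : 'X_{1..s} := [multinom of sort leq a].

Definition Gamma_lt a b : bool :=
  lex_lt (Gamma b) (Gamma a) || (Gamma b == Gamma a) && lex_lt b a.

Lemma Gamma_lt_irr : irreflexive Gamma_lt.
Proof. by move=> a; rewrite /Gamma_lt !lex_lt_irr andbF. Qed.

Lemma Gamma_lt_trans : transitive Gamma_lt.
Proof.
move=> b a c; rewrite /Gamma_lt.
case/orP => [ab|/andP[/eqP <- ab]]; case/orP => [bc|/andP[/eqP -> bc]].
- by rewrite (lex_lt_trans bc ab).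
- by rewrite ab.
- by rewrite bc.
- by rewrite eqxx (lex_lt_trans bc ab) orbT.
Qed.

Lemma Gamma_lt_total a b : a != b -> Gamma_lt a b || Gamma_lt b a.
Proof.
rewrite /Gamma_lt => ab; have [e|ne] := eqVneq (Gamma b) (Gamma a).
  by rewrite e lex_lt_irr /= orbC; exact: lex_lt_total.
by rewrite /= !orbF; exact: lex_lt_total.
Qed.

End GammaOrder.

(* The polynomial ring in the variables x_a, for a : mnmd s d, is
   {mpoly K[#|{: mnmd s d}|]}; x_a is the variable of index [enum_rank a]. *)
Section PrecGamma.
Variables s d : nat.
Local Notation N := #|{: mnmd s d}|.

Definition var_lt (i j : 'I_N) : bool := Gamma_lt (enum_val i) (enum_val j).

Lemma var_lt_irr : irreflexive var_lt.
Proof. by move=> i; exact: Gamma_lt_irr. Qed.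

Lemma var_lt_trans : transitive var_lt.
Proof. by move=> j i k; exact: Gamma_lt_trans. Qed.

Lemma var_lt_total i j : i != j -> var_lt i j || var_lt j i.
Proof.
by move=> ij; apply: Gamma_lt_total; rewrite (inj_eq val_inj)
  (inj_eq enum_val_inj).
Qed.

Definition prec_Gamma : term_order N :=
  revlex var_lt_irr var_lt_trans var_lt_total.

End PrecGamma.

Section Veronese.
Variables (K : fieldType) (s d : nat).
Local Notation Rd := {mpoly K[#|{: mnmd s d}|]}.

Definition phi (f : Rd) : {mpoly K[s]} :=
  f \mPo [tuple 'X_[enum_val i : mnmd s d] | i < #|{: mnmd s d}|].

Definition ker_phi (f : Rd) : Prop := phi f = 0.

(* The variable x_m, for an exponent vector m of degree d; the value 0 in other
   degrees is a dummy that is never used below. *)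
Definition xvar (m : 'X_{1..s}) : Rd :=
  if insub m is Some a then 'X_(enum_rank (a : mnmd s d)) else 0.

Definition exchange (a b : 'X_{1..s}) (i j : 'I_s) : Rd :=
  xvar (a + U_(i)) * xvar (b + U_(j)) - xvar (a + U_(j)) * xvar (b + U_(i)).

Lemma phi_xvar m : mdeg m = d -> phi (xvar m) = 'X_[m].
Proof.
move=> md; rewrite /xvar; case: insubP => [a _ <-|]; last by rewrite md eqxx.
by rewrite /phi comp_mpolyXU -tnth_nth tnth_mktuple enum_rankK.
Qed.

(* Intended for 0 < d, so that d.-1 is the integer d - 1. *)
Definition G_Gamma : seq Rd :=
  let T : finType := ((mnmd s d.-1 * mnmd s d.-1) * ('I_s * 'I_s))%type in
  [seq exchange t.1.1 t.1.2 t.2.1 t.2.2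
     | t : T <- enum T & (t.2.1 < t.2.2)%N].

End Veronese.

(* Main.v *)
(* It suffices that the leading monomial u of any f in the kernel is divisible by
   the leading monomial of an element of G_Gamma. Some other monomial v of f has
   the same image as u, and v is smaller than u: below some variable x_m they
   agree, and x_m has a larger exponent in v. Let x_a be the smallest variable of
   u above x_m. Then m is bounded by the image of the part of u above x_m. Moving
   one unit of a from a coordinate q with a_q > m_q to a coordinate p with
   a_p < m_p can be done so that x_a decreases (exists_improving), and since
   a_p < m_p some other factor x_b of that part of u has b_p > 0 and can absorb
   the opposite move. The resulting exchange binomial has leading monomial
   x_a x_b, because the exchange creates a variable smaller than both. *)
Require Import Defs.
From mathcomp Require Import all_boot all_order all_algebra.
From mathcomp Require Import zify.

Set Implicit Arguments.
Unset Strict Implicit.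
Unset Printing Implicit Defensive.

Import GRing.Theory.

(** * Sorted lists after balancing two entries *)

Lemma sort_transfer_lex (r : seq nat) (x y : nat) : x.+1 < y ->
  let s := sort leq [:: x, y & r] in
  let t := sort leq [:: x.+1, y.-1 & r] in
  exists2 k, k < (size r).+2 &
    nth 0 s k < nth 0 t k /\ forall j, j < k -> nth 0 s j = nth 0 t j.
Proof.
move=> xy s t.
(* Both sorted lists start with [F], the sorted entries of [r] that are at most [x]. Right after it,
   [s] still has its extra [x], while everything left in [t] exceeds [x]; the first difference is at
   index [size F]. *)
pose F := sort leq [seq z <- r | z <= x].
pose H := [seq z <- r | ~~ (z <= x)].
pose S := sort leq (y :: H); pose T := sort leq [:: x.+1, y.-1 & H].
have memF z : z \in F -> z <= x by rewrite mem_sort mem_filter => /andP[].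
have memH z : z \in H -> x < z by rewrite mem_filter -ltnNge => /andP[].
have memS z : z \in S -> x < z.
  by rewrite mem_sort inE => /predU1P[->|/memH //]; lia.
have memT z : z \in T -> x < z.
  by rewrite mem_sort !inE => /predU1P[->//|/predU1P[->|/memH //]]; lia.
have countr P : count P r = count P F + count P H.
  by rewrite count_sort -count_cat; apply/permP; rewrite perm_sym perm_filterC.
have sortedE u v : sorted leq u -> perm_eq v u -> sort leq v = u.
  move=> su uv; apply: (sorted_eq leq_trans anti_leq) => //.
    exact: sort_sorted leq_total _.
  by rewrite perm_sort.
have sE : s = F ++ x :: S.
  apply: sortedE.
    rewrite (sorted_pairwise leq_trans).
    rewrite pairwise_cat allrel_consr pairwise_cons.
    rewrite -!(sorted_pairwise leq_trans) !(sort_sorted leq_total) !andbT.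
    apply/andP; split; last by apply/allP => z /memS /ltnW.
    apply/andP; split; first by apply/allP => z /memF.
    by apply/allrelP => z w /memF zx /memS xw; lia.
  by apply/permP => P; rewrite count_cat /= countr !count_sort /=; lia.
have tE : t = F ++ T.
  apply: sortedE.
    rewrite (sorted_pairwise leq_trans) pairwise_cat.
    rewrite -!(sorted_pairwise leq_trans) !(sort_sorted leq_total) !andbT.
    by apply/allrelP => z w /memF zx /memT xw; lia.
  by apply/permP => P; rewrite count_cat /= countr !count_sort /=; lia.
exists (size F).
  by rewrite ltnS size_sort size_filter (leq_trans (count_size _ _)).
split=> [|j jF]; rewrite sE tE !nth_cat ?jF // ltnn subnn /=.
by apply: memT; rewrite mem_nth // size_sort.
Qed.

(** * Unit moves between coordinates and the order on the variables *)

Section Transfer.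
Variable s : nat.
Implicit Types (a m : 'X_{1..s}) (p q : 'I_s).

(** The subtraction is truncated, so the degree is preserved only when [0 < a q]. *)
Definition transfer a q p : 'X_{1..s} := (a - U_(q) + U_(p))%MM.

Lemma transferE a q p i :
  transfer a q p i = a i - (q == i) + (p == i).
Proof. by rewrite mnmDE mnmBE !mnm1E. Qed.

Lemma transferK a q p : 0 < a q -> p != q ->
  transfer (transfer a q p) p q = a.
Proof.
move=> aq pq; apply/mnmP => i; rewrite !transferE.
by case: (eqVneq q i) => [<-|_]; rewrite ?(negPf pq) //=; lia.
Qed.

Lemma mdeg_transfer a q p : 0 < a q -> mdeg (transfer a q p) = mdeg a.
Proof.
move=> aq; rewrite -{2}[a](@submK _ U_(q)) ?lep1mP -?lt0n //.
by rewrite !mdegD !mdeg1.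
Qed.

Lemma Gamma_nth a (i : 'I_s) : Gamma a i = nth 0 (sort leq a) i.
Proof. by rewrite mnm_tnth (tnth_nth 0). Qed.

(** Since [r] does not depend on [a], a vector and its transfer share the same remaining entries. *)
Lemma perm_split_two p q : p != q ->
  exists2 r, forall a, perm_eq a [:: a p, a q & [seq a i | i <- r]]
           & {in r, forall i, (i != p) && (i != q)}.
Proof.
move=> pq; exists (rem q (rem p (enum 'I_s))).
  move=> a; rewrite -{1}(map_tnth_enum a) -!(map_cons a).
  apply: perm_map; apply: perm_trans (perm_to_rem (mem_enum _ p)) _.
  rewrite perm_cons; apply: perm_to_rem.
  by rewrite mem_rem_uniq ?enum_uniq // !inE mem_enum eq_sym pq.
move=> i; rewrite mem_rem_uniq ?rem_uniq ?enum_uniq // inE.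
by rewrite mem_rem_uniq ?enum_uniq // inE => /and3P[-> -> _].
Qed.

(* The moves of one unit that decrease the variable: they balance [a], or they
   exchange values [a p = t], [a q = t + 1] with [p < q]. *)
Definition improving a q p : bool :=
  ((a p).+1 < a q) || (a q == (a p).+1) && (p < q).

(** A gap of at least two makes the sorted vector lexicographically larger. A gap of one swaps two
    values: [Gamma] is unchanged, and with [p < q] the vector itself grows lexicographically, first
    at [p]. *)
Lemma improving_lt a q p : improving a q p -> Gamma_lt (transfer a q p) a.
Proof.
move=> imp.
have pq : p != q by apply: contraTneq imp => ->; rewrite /improving; lia.
have aq : 0 < a q by move: imp; rewrite /improving; lia.
have [r pr rP] := perm_split_two pq.
have pr' : perm_eq (transfer a q p) [:: (a p).+1, (a q).-1 & [seq a i | i <- r]].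
  have := pr (transfer a q p); rewrite !transferE !eqxx (negPf pq) eq_sym (negPf pq).
  rewrite subn0 addn0 addn1 subn1; congr perm_eq; congr [:: _, _ & _].
  apply/eq_in_map => i /rP /andP[ip iq]; rewrite transferE.
  by rewrite ![_ == i]eq_sym (negPf ip) (negPf iq) subn0 addn0.
have srt u v : perm_eq u v -> sort leq u = sort leq v.
  by move=> uv; apply/(perm_sortP leq_total leq_trans anti_leq).
rewrite /Gamma_lt; case/orP: imp => [lt2|/andP[/eqP aqE ltpq]]; apply/orP.
  left; have [k ks [ltk below]] := sort_transfer_lex [seq a i | i <- r] lt2.
  have sz : (size r).+2 = s.
    by have := perm_size (pr a); rewrite size_tuple /= size_map.
  rewrite size_map sz in ks; apply/first_ltP; exists (Ordinal ks) => [|j jk].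
    by rewrite !Gamma_nth (srt _ _ (pr a)) (srt _ _ pr').
  by rewrite !Gamma_nth (srt _ _ (pr a)) (srt _ _ pr') below.
right; apply/andP; split.
  apply/eqP/mnmP => i; rewrite !Gamma_nth; congr nth; apply: srt.
  apply: perm_trans (pr a) _; rewrite perm_sym.
  apply: perm_trans pr' _; rewrite aqE /=.
  by apply/permP => P /=; lia.
apply/first_ltP; exists p => [|j jp]; rewrite transferE.
  by rewrite eqxx [q == p]eq_sym (negPf pq); lia.
have /negPf-> : p != j by apply: contraTneq jp => ->; rewrite ltnn.
have /negPf-> : q != j by apply: contraTneq jp => <-; lia.
lia.
Qed.

(** Undoing a move that is not improving is an improving move. *)
Lemma not_improving_gt a q p : 0 < a q -> p != q -> ~~ improving a q p ->
  Gamma_lt a (transfer a q p).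
Proof.
move=> aq pq nimp; rewrite -{1}(transferK aq pq); apply: improving_lt.
move: nimp; have : p <> q :> nat by move/val_inj/eqP; exact/negP.
rewrite /improving !transferE !eqxx [q == p]eq_sym (negPf pq); lia.
Qed.

(* Walk from [a] to [m] by unit moves; each move shrinks the surpluses of [a]
   over [m] and its deficits, so a move improving the walked point already
   improves [a], and if no move improves then the variable never decreases. *)
Lemma exists_improving a m : mdeg a = mdeg m -> Gamma_lt m a ->
  exists q p, [/\ m q < a q, a p < m p & improving a q p].
Proof.
have [n] := ubnP (\sum_i (a i - m i)); elim: n a => // n IH a le_n dg lt_ma.
have neq : a != m by apply: contraTneq lt_ma => ->; rewrite Gamma_lt_irr.
have surplus u v : mdeg u = mdeg v -> u != v -> exists q : 'I_s, v q < u q.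
  move=> duv neq_uv; apply/existsP; apply: contraR neq_uv => /existsPn none.
  have le j : u j <= v j by rewrite leqNgt none.
  apply/eqP/mnmP => i.
  apply/eqP; rewrite eqn_leq le /= leqNgt; apply/negP => lt.
  suff : mdeg u < mdeg v by rewrite duv ltnn.
  rewrite !mdegE (bigD1 i) //= [ltnRHS](bigD1 i) //= -addSn leq_add //.
  by apply: leq_sum => j _.
have [q mq] := surplus _ _ dg neq.
have [|p ap] := surplus m a (esym dg); first by rewrite eq_sym.
have [imp|nimp] := boolP (improving a q p); first by exists q, p.
have pq : p != q by apply: contraTneq mq => <-; lia.
have aq : 0 < a q by lia.
have lt_a := not_improving_gt aq pq nimp.
have [] := IH (transfer a q p).
(* The surplus drops by one at [q] and stays zero at [p], whose value rises to at most [m p]. *)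
- rewrite -ltnS; apply: leq_trans le_n; rewrite ltnS (bigD1 q) //= [ltnRHS](bigD1 q) //=.
  rewrite -addSn leq_add //.
    by rewrite transferE eqxx (negPf pq); lia.
  apply: leq_sum => i; rewrite transferE; case: (eqVneq p i) => [<-|_]; lia.
- by rewrite mdeg_transfer.
- exact: Gamma_lt_trans lt_a.
move=> q' [p' []]; rewrite /improving !transferE => mq' ap' imp'.
(* After the move, [p] has no surplus and [q] no deficit. Hence the walked point is at most [a] at
   [q'] and at least [a] at [p'], and the improvement carries over to [a]. *)
have /negPf pq' : p != q' by apply: contraTneq mq' => <-; lia.
have /negPf qp' : q != p' by apply: contraTneq ap' => <-; lia.
by exists q', p'; move: mq' ap' imp'; rewrite pq' qp'; split; lia.
Qed.
End Transfer.

(** * Initial ideals, binomials and minimal elements *)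

Section InitialIdeal.
Local Open Scope ring_scope.
Variables (K : fieldType) (n : nat) (lt : term_order n).
Local Notation R := {mpoly K[n]}.
Implicit Types (f : R) (I J : R -> Prop).

(** Reduces inclusion of initial ideals to divisibility of single monomials: the cofactors
    ['X_[u - m]] are absorbed into the coefficients. *)
Lemma initial_ideal_dvd I J :
  (forall f u, I f -> is_initial lt f u ->
    exists g m, [/\ J g, is_initial lt g m & (m <= u)%MM]) ->
  forall f, initial_ideal lt I f -> initial_ideal lt J f.
Proof.
move=> dvd f [k [h [g [inI ->]]]].
have /fin_all_exists[w] (i : 'I_k) :
    exists w : 'X_{1..n} * 'X_{1..n}, initials lt J 'X_[w.1] /\ g i = 'X_[w.2] * 'X_[w.1].
  have [f' [u [If' uf' ->]]] := inI i.
  have [g' [m [Jg' mg' mu]]] := dvd _ _ If' uf'.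
  exists (m, (u - m)%MM) => /=; split; first by exists g', m.
  by rewrite -mpolyXD submK.
move=> wP; exists k, (fun i => h i * 'X_[(w i).2]), (fun i => 'X_[(w i).1]).
split=> [i|]; first by have [] := wP i.
by apply: eq_bigr => i _; have [_ ->] := wP i; rewrite mulrA.
Qed.

Lemma is_initial_binomial (u v : 'X_{1..n}) :
  lt v u -> is_initial lt ('X_[u] - 'X_[v] : R) u.
Proof.
move=> lt_vu.
have neq : v != u by apply: contraTneq lt_vu => ->; rewrite to_irr.
split; first by rewrite mcoeff_msupp mcoeffB !mcoeffX eqxx (negPf neq) subr0 oner_eq0.
move=> w; rewrite mcoeff_msupp mcoeffB !mcoeffX => supp wu.
suff -> : w = v by [].
apply/eqP; apply: contraR supp => wv.
by rewrite [u == w]eq_sym (negPf wu) [v == w]eq_sym (negPf wv) subrr eqxx.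
Qed.
End InitialIdeal.

(** An element with the fewest predecessors is minimal, because passing to a predecessor strictly
    shrinks that set. *)
Lemma exists_minimal (T : finType) (r : rel T) (P : pred T) (x0 : T) :
  irreflexive r -> transitive r -> P x0 ->
  exists2 x, P x & forall y, P y -> ~~ r y x.
Proof.
move=> irr tr Px0.
case: (arg_minnP (fun x => #|[pred y | r y x]|) Px0) => x Px minx.
exists x => // y /minx; apply: contraL => ryx; rewrite -ltnNge.
apply: proper_card; apply/properP; split.
  by apply/subsetP => z; rewrite !inE => /tr; apply.
by exists y; rewrite !inE ?irr.
Qed.

(** * The kernel of [phi] and its fibers on monomials *)

Section Veronese.
Variables (K : fieldType) (s d : nat).
Hypothesis d_gt0 : 0 < d.
Local Notation N := #|{: mnmd s d}|.
Local Notation Rd := {mpoly K[N]}.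
Implicit Types (u v : 'X_{1..N}) (a b : 'X_{1..s}).

Definition label (i : 'I_N) : 'X_{1..s} := enum_val i.

Definition image_mnm u : 'X_{1..s} := (\sum_(i < N) label i *+ u i)%MM.

Lemma mdeg_label i : mdeg (label i) = d.
Proof. exact/eqP/mnmd_deg. Qed.

Lemma labelP a : mdeg a = d -> exists i, label i = a.
Proof. by move=> /eqP da; exists (enum_rank (Mnmd da)); rewrite /label enum_rankK. Qed.

Lemma xvar_label i : xvar K d (label i) = 'X_i.
Proof. by rewrite /xvar /label valK enum_valK. Qed.

Lemma image_mnmE u k : image_mnm u k = \sum_(i < N) label i k * u i.
Proof. by rewrite mnm_sumE; apply: eq_bigr => i _; rewrite mulmnE. Qed.

Lemma mdeg_image u : mdeg (image_mnm u) = d * mdeg u.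
Proof.
rewrite mdeg_sum mdegE big_distrr; apply: eq_bigr => i _.
by rewrite mdegMn mdeg_label.
Qed.

Lemma phiX u : phi ('X_[u] : Rd) = 'X_[image_mnm u].
Proof.
rewrite /phi comp_mpolyX -mprodXnE; apply: eq_bigr => i _.
by rewrite tnth_mktuple.
Qed.

(** [phi] maps monomials to monomials; if [u] were alone in its fiber, its nonzero coefficient would
    survive in [phi f]. *)
Lemma ker_phi_fiber (f : Rd) u : ker_phi f -> u \in msupp f ->
  exists v, [/\ v \in msupp f, v != u & image_mnm v = image_mnm u].
Proof.
move=> kf uf.
suff /hasP[v vf /andP[vu /eqP e]] :
    has (fun v => (v != u) && (image_mnm v == image_mnm u)) (msupp f).
  by exists v.
apply/negPn/negP => /hasPn none.
have : ((phi f)@_(image_mnm u) = 0)%R by rewrite kf mcoeff0.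
rewrite /phi comp_mpolyEX raddf_sum (bigD1_seq u) ?msupp_uniq //= mcoeffZ.
rewrite -/(phi 'X_[u]) phiX mcoeffX eqxx mulr1 big_seq_cond big1 ?addr0.
  by apply/eqP; rewrite -mcoeff_msupp.
move=> v /andP[/none + vu]; rewrite vu /= => /negPf neq.
by rewrite mcoeffZ -/(phi 'X_[v]) phiX mcoeffX neq mulr0.
Qed.

Lemma exchangeC a b i j : exchange K d a b i j = exchange K d b a j i.
Proof. by rewrite /exchange mulrC [X in (_ - X)%R]mulrC. Qed.

(** The case [j < i] follows by swapping [a] with [b] as well. *)
Lemma mem_G_Gamma a b i j : mdeg a = d.-1 -> mdeg b = d.-1 -> i != j ->
  exchange K d a b i j \in G_Gamma K s d.
Proof.
wlog lt_ij : a b i j / i < j => [thm da db ij|/eqP da /eqP db _].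
  case: (ltngtP i j) => [lt|lt|/val_inj e]; first exact: thm.
    by rewrite exchangeC; apply: thm; rewrite // eq_sym.
  by rewrite e eqxx in ij.
by apply/mapP; exists ((Mnmd da, Mnmd db), (i, j)); rewrite // mem_filter lt_ij mem_enum.
Qed.

Lemma ker_phi_G_Gamma g : g \in G_Gamma K s d -> ker_phi g.
Proof.
case/mapP => -[[a b] [i j]] _ -> /=.
have da (c : mnmd s d.-1) k : mdeg (c + U_(k))%MM = d.
  by rewrite mdegD mdeg1 (eqP (mnmd_deg c)) addn1 prednK.
have phiE (f1 f2 f3 f4 : Rd) :
    phi (f1 * f2 - f3 * f4)%R = (phi f1 * phi f2 - phi f3 * phi f4)%R.
  by rewrite /phi rmorphB !rmorphM.
rewrite /ker_phi phiE !phi_xvar //.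
rewrite -!mpolyXD; apply/eqP; rewrite subr_eq0; apply/eqP; congr 'X_[_].
by apply/mnmP => k; rewrite !mnmDE; lia.
Qed.

(* Only the indices above [i0] matter, since [u] and [v] agree below it. *)
Lemma label_le_tail u v i0 k : image_mnm v = image_mnm u -> u i0 < v i0 ->
  (forall j, var_lt j i0 -> u j = v j) ->
  label i0 k <= \sum_(j | var_lt i0 j) label j k * u j.
Proof.
move=> e lt eq_below.
have split w : image_mnm w k = label i0 k * w i0
    + \sum_(j | var_lt i0 j) label j k * w j
    + \sum_(j | var_lt j i0) label j k * w j.
  rewrite image_mnmE (bigD1 i0) //= (bigID (var_lt i0)) /= addnA.
  congr (_ + _ + _); apply: eq_bigl => j.
    by case: eqVneq => // ->; rewrite var_lt_irr.
  have [->|/var_lt_total] := eqVneq j i0; first by rewrite !var_lt_irr.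
  case: (boolP (var_lt i0 j)) => [lt1 _ /=|_ /=]; last by rewrite orbF.
  apply/esym/negP => lt2; have := var_lt_trans lt1 lt2.
  by rewrite var_lt_irr.
have tailE : \sum_(j | var_lt j i0) label j k * u j
    = \sum_(j | var_lt j i0) label j k * v j.
  by apply: eq_bigr => j /eq_below ->.
(* The parts below [i0] cancel, and the additional copies of [label i0] in [v] must be compensated
   by the tail of [u]. *)
have cancel L x y A B C : L * y + B + C = L * x + A + C -> x < y -> L <= A by nia.
have := congr1 (fun w : 'X_{1..s} => w k) e; rewrite /= !split tailE => ek.
exact: cancel ek lt.
Qed.

(** * Initial monomials of the exchange binomials *)

Lemma prec_Gamma_pair (i j i' j' : 'I_N) :
  var_lt i' i -> ~~ var_lt j i ->
  prec_Gamma s d (U_(i') + U_(j'))%MM (U_(i) + U_(j))%MM.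
Proof.
(* Here [x] is the smaller variable of the new pair. It lies below both [i] and [j], so it is the
   first difference and occurs only in the new monomial. *)
have key (x y : 'I_N) : var_lt x i -> ~~ var_lt j i -> ~~ var_lt y x ->
    first_lt (@var_lt s d) (U_(i) + U_(j))%MM (U_(x) + U_(y))%MM.
  move=> xi ji yx.
  have fresh k : var_lt k i -> (U_(i) + U_(j))%MM k = 0.
    move=> ki; rewrite mnmDE !mnm1E.
    have /negPf-> : i != k by apply: contraTneq ki => ->; rewrite var_lt_irr.
    by have /negPf-> : j != k by apply: contraTneq ki => <-.
  apply/first_ltP; exists x => [|k kx].
    by rewrite fresh // mnmDE !mnm1E eqxx.
  rewrite fresh ?(var_lt_trans kx) //.
  have /negPf xk : x != k by apply: contraTneq kx => ->; rewrite var_lt_irr.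
  have /negPf yk : y != k by apply: contraTneq kx => <-.
  by rewrite mnmDE !mnm1E xk yk.
move=> i'i ji; apply/orP; right; rewrite !mdegD !mdeg1 eqxx /=.
have [ji'|] := boolP (var_lt j' i'); last exact: key.
rewrite [X in first_lt _ _ X]addmC; apply: key => //.
  exact: var_lt_trans i'i.
by apply/negP => /(var_lt_trans ji'); rewrite var_lt_irr.
Qed.

Lemma G_Gamma_initial_le u v : image_mnm v = image_mnm u ->
  prec_Gamma s d v u ->
  exists (g : Rd) m, [/\ g \in G_Gamma K s d, is_initial (prec_Gamma s d) g m
                & (m <= u)%MM].
Proof.
move=> e; have dgE : mdeg v = mdeg u.
  by have := congr1 mdeg e; rewrite !mdeg_image; nia.
case/orP => [|/andP[_ /first_ltP[i0 lt0 below]]]; first by rewrite dgE ltnn.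
have tail k := label_le_tail k e lt0 below.
(* As [d > 0], [label i0] has a nonzero coordinate; the tail bound there yields a variable of [u]
   above [i0]. *)
have [k0 k0P] : exists k, 0 < label i0 k.
  apply/existsP; apply: contraLR d_gt0 => /existsPn all0.
  rewrite -(mdeg_label i0) mdegE big1 // => k _.
  by apply/eqP; rewrite -leqn0 leqNgt all0.
have [j0 j0P] : exists j, var_lt i0 j && (0 < u j).
  apply/existsP; apply: contraLR k0P => /existsPn all0.
  rewrite -leqNgt (leq_trans (tail k0)) // big1 // => j lt_j.
  by have := all0 j; rewrite lt_j /= lt0n negbK => /eqP->; rewrite muln0.
have [i /andP[lt_i ui] mini] := @exists_minimal _ (@var_lt s d)
  [pred j | var_lt i0 j && (0 < u j)] j0 (@var_lt_irr s d) (@var_lt_trans s d) j0P.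
have [||q [p [mq ap imp]]] := @exists_improving _ (label i) (label i0).
- by rewrite !mdeg_label.
- exact: lt_i.
have [j [jp lt_j le_u]] : exists j,
    [/\ 0 < label j p, var_lt i0 j && (0 < u j) & (U_(i) + U_(j) <= u)%MM].
  have [/existsP[j /and3P[ji lt_j]]|/existsPn none] := boolP [exists j : 'I_N,
      [&& j != i, var_lt i0 j & 0 < label j p * u j]].
    rewrite muln_gt0 => /andP[jp uj]; exists j; rewrite lt_j uj; split=> //.
    apply/mnm_lepP => k; rewrite mnmDE !mnm1E.
    case: (eqVneq i k) ji => [<-|_]; first by move/negPf->; rewrite addn0.
    by case: (eqVneq j k) => [<-|].
  have sumE : \sum_(j | var_lt i0 j) label j p * u j = label i p * u i.
    rewrite (bigD1 i) //= big1 ?addn0 // => j /andP[lt_j ji].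
    by have := none j; rewrite ji lt_j /= lt0n negbK => /eqP.
  (* Only [i] contributes at [p], so [label i p < label i p * u i]. This forces [0 < label i p] and
     [1 < u i]: a second copy of the same variable serves as [j]. *)
  have := leq_trans ap (tail p); rewrite sumE => lt_p.
  exists i; rewrite lt_i ui; split=> //; first by nia.
  apply/mnm_lepP => k; rewrite mnmDE !mnm1E.
  by case: (eqVneq i k) => [<-|] //; nia.
have pq : p != q by apply: contraTneq mq => <-; lia.
have aq : 0 < label i q by lia.
have [i' i'E] := labelP (etrans (mdeg_transfer p aq) (mdeg_label i)).
have [j' j'E] := labelP (etrans (mdeg_transfer q jp) (mdeg_label j)).
(* Removing the units at [q] and [p] makes the first term the product of the variables [i] and [j],
   and the second that of [i'] and [j']. *)
exists (exchange K d (label i - U_(q)) (label j - U_(p)) q p), (U_(i) + U_(j))%MM.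
have le1 k r : 0 < label k r -> (U_(r) <= label k)%MM by rewrite lep1mP lt0n.
split=> //.
- apply: mem_G_Gamma; last by rewrite eq_sym.
    by rewrite -(mdeg_label i) -{2}[label i](submK (le1 _ _ aq)) mdegD mdeg1 addn1.
  by rewrite -(mdeg_label j) -{2}[label j](submK (le1 _ _ jp)) mdegD mdeg1 addn1.
rewrite /exchange !submK ?le1 // -/(transfer _ _ _) -/(transfer _ _ _).
rewrite -i'E -j'E !xvar_label -!mpolyXD.
apply: is_initial_binomial; apply: prec_Gamma_pair; last exact: mini.
by rewrite /var_lt -/(label _) -/(label _) i'E; apply: improving_lt.
Qed.
End Veronese.

Theorem theorem3p8 (K : fieldType) (s d : nat) (hs : (0 < s)%N) (hd : (0 < d)%N) :
  is_groebner_basis (prec_Gamma s d) (G_Gamma K s d) (@ker_phi K s d).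
Proof.
split=> [g|f]; first exact: ker_phi_G_Gamma.
split; apply: initial_ideal_dvd => {}f u.
  move=> kf [uf maxu]; have [v [vf vu e]] := ker_phi_fiber kf uf.
  exact: (G_Gamma_initial_le K hd e (maxu v vf vu)).
by move=> fG uf; exists f, u; split; rewrite ?lepm_refl //; exact: ker_phi_G_Gamma.
Qed.
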